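(* Let $G$ be a graph and $G^2$ its square. If $G$ admits a straight-line drawing with ply $1$, then $G^2$ admits an empty-ply drawing. Moreover, if $G$ is a subgraph of the triangular tiling, then $G^2$ admits an empty-ply drawing with ply at most $4$.
   Context: The square $G^2$ of a graph $G$ is obtained from $G$ by adding an edge between every two distinct vertices at distance $2$ in $G$. The triangular tiling is the infinite plane graph formed by the vertices and edges of the tiling of the plane by congruent equilateral triangles. A straight-line drawing of a graph places each vertex at a distinct point of the plane and draws each edge as the straight-line segment between its endpoints (edges are allowed to overlap). For each vertex $v$, the ply-disk $D_v$ is the open disk centered at $v$ with radius equal to half the length of the longest edge incident to $v$. The ply of a drawing is the maximum, over all points $p$ of the plane, of the number of ply-disks containing $p$ in their interior. A drawing is empty-ply if every ply-disk $D_v$ contains no vertex other than $v$ in its interior. *)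

(* Defs.v *)
From HB Require Import structures.
From mathcomp Require Import all_boot all_order all_algebra.
From mathcomp Require Import ring lra zify.
From mathcomp Require Import mathcomp_extra boolp classical_sets cardinality reals.
Set Implicit Arguments.
Unset Strict Implicit.
Unset Printing Implicit Defensive.
Import Order.TTheory GRing.Theory Num.Theory.
Local Open Scope classical_set_scope.
Local Open Scope ring_scope.

Record sgraph (V : Type) := SGraph {
  adj : V -> V -> Prop;
  adj_sym : forall u v, adj u v -> adj v u;
  adj_irrefl : forall v, ~ adj v v }.

Fixpoint walk (V : Type) (G : sgraph V) (n : nat) (u v : V) : Prop :=
  if n is m.+1 then exists w, adj G u w /\ walk G m w v else u = v.

Definition at_distance (V : Type) (G : sgraph V) (n : nat) (u v : V) : Prop :=
  walk G n u v /\ forall m, (m < n)%N -> ~ walk G m u v.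

Definition square_adj (V : Type) (G : sgraph V) (u v : V) : Prop :=
  adj G u v \/ (u <> v /\ at_distance G 2 u v).

Lemma walk_rcons (V : Type) (G : sgraph V) n u v w :
  walk G n u v -> adj G v w -> walk G n.+1 u w.
Proof.
elim: n u => [u /= -> vw|n IH u /= [x [ux xv]] vw]; first by exists w.
by exists x; split=> //; exact: IH.
Qed.

Lemma walk_sym (V : Type) (G : sgraph V) n u v : walk G n u v -> walk G n v u.
Proof.
elim: n u => [u -> //|n IH u [x [ux xv]]].
exact: walk_rcons (IH _ xv) (adj_sym ux).
Qed.

Lemma square_adj_sym (V : Type) (G : sgraph V) u v :
  square_adj G u v -> square_adj G v u.
Proof.
case=> [uv|[uv [w2 min2]]]; first by left; exact: adj_sym.
right; split; first by move=> vu; apply: uv.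
split; first exact: walk_sym.
by move=> m mlt vu; apply: (min2 m mlt); exact: walk_sym.
Qed.

Lemma square_adj_irrefl (V : Type) (G : sgraph V) v : ~ square_adj G v v.
Proof. by case=> [vv|[]//]; exact: (@adj_irrefl V G v). Qed.

Definition square (V : Type) (G : sgraph V) : sgraph V :=
  SGraph (@square_adj_sym V G) (@square_adj_irrefl V G).

(* The library norm on R * R is the sup norm, hence this Euclidean distance. *)
Definition edist (R : realType) (p q : R * R) : R :=
  Num.sqrt ((p.1 - q.1) ^+ 2 + (p.2 - q.2) ^+ 2).

(* Edges are the segments determined by their endpoints and may overlap, so a
   straight-line drawing amounts to an injective placement of the vertices. *)
Definition drawing (R : realType) (V : Type) (d : V -> R * R) : Prop :=
  injective d.

Definition longest_edge (R : realType) (V : Type) (G : sgraph V)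
    (d : V -> R * R) (v : V) (l : R) : Prop :=
  (exists w, adj G v w /\ edist (d v) (d w) = l) /\
  (forall w, adj G v w -> edist (d v) (d w) <= l).

(* An isolated vertex has no longest edge; its disk is empty, as is an open disk
   of radius 0. *)
Definition ply_disk (R : realType) (V : Type) (G : sgraph V)
    (d : V -> R * R) (v : V) : set (R * R) :=
  [set p | exists l, longest_edge G d v l /\ edist (d v) p < l / 2].

Definition disks_at (R : realType) (V : Type) (G : sgraph V)
    (d : V -> R * R) (p : R * R) : set V :=
  [set v | ply_disk G d v p].

(* k is the maximum of #|disks_at G d p| over all points p of the plane. *)
Definition has_ply (R : realType) (V : Type) (G : sgraph V)
    (d : V -> R * R) (k : nat) : Prop :=
  (forall p, (disks_at G d p #<= `I_k)%card) /\
  (exists p, (disks_at G d p #= `I_k)%card).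

Definition empty_ply (R : realType) (V : Type) (G : sgraph V)
    (d : V -> R * R) : Prop :=
  forall v w, w <> v -> ~ ply_disk G d v (d w).

(* The triangular tiling: (a, b) stands for the point a (1, 0) + b (1/2, sqrt 3/2)
   of the tiling with side 1; tri_adjE checks that edges are the pairs at
   distance 1. *)
Definition tri_adj (x y : int * int) : bool :=
  (y.1 - x.1, y.2 - x.2) \in
  [:: (1, 0); (0, 1); (-1, 1); (-1, 0); (0, -1); (1, -1)].

Definition tri_pos (R : realType) (x : int * int) : R * R :=
  (x.1%:~R + x.2%:~R / 2, x.2%:~R * (Num.sqrt 3 / 2)).

Lemma tri_adjE (R : realType) (x y : int * int) :
  tri_adj x y <-> edist (tri_pos R x) (tri_pos R y) = 1.
Proof.
case: x y => [x1 x2] [y1 y2]; rewrite /tri_adj /edist /tri_pos /=.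
set a : int := y1 - x1; set b : int := y2 - x2.
have -> : (x1%:~R + x2%:~R / 2 - (y1%:~R + y2%:~R / 2)) ^+ 2 +
    (x2%:~R * (Num.sqrt 3 / 2) - y2%:~R * (Num.sqrt 3 / 2)) ^+ 2 =
    (a ^+ 2 + a * b + b ^+ 2)%:~R :> R.
  have s3 : Num.sqrt 3 ^+ 2 = 3 :> R by rewrite sqr_sqrtr.
  rewrite -mulrBl exprMn expr_div_n s3 /a /b.
  by rewrite !(intrD, intrM, rmorphXn, rmorphB) /=; field.
split=> [|h].
  by rewrite !inE => /or4P[|||/or3P[||]] /eqP[-> ->]; rewrite sqrtr1.
have : (a ^+ 2 + a * b + b ^+ 2)%:~R = 1%:~R :> R.
  rewrite -[LHS]sqr_sqrtr ?h ?expr1n // leNgt; apply/negP => /ltW/ler0_sqrtr h0.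
  by move: h; rewrite h0 => /esym/eqP; rewrite oner_eq0.
move=> /intr_inj {h}.
move: a b => a b h.
have ha : -1 <= a <= 1 by apply/andP; split; nia.
have hb : -1 <= b <= 1 by apply/andP; split; nia.
have [] : [\/ a = -1, a = 0 | a = 1].
- have : (a = -1) \/ (a = 0) \/ (a = 1) by lia.
  by case=> [|[]]; [constructor 1|constructor 2|constructor 3].
all: move=> ?; subst a.
all: have : (b = -1) \/ (b = 0) \/ (b = 1) by lia.
all: by case=> [|[]] ?; subst b.
Qed.

Lemma tri_adj_sym (x y : int * int) : tri_adj x y -> tri_adj y x.
Proof.
case: x y => [x1 x2] [y1 y2]; rewrite /tri_adj /= -(opprB y1) -(opprB y2) !inE.
by move=> /or4P[|||/or3P[||]] /eqP[-> ->].
Qed.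

Lemma tri_adj_irrefl (x : int * int) : ~ tri_adj x x.
Proof. by rewrite /tri_adj !subrr. Qed.

Definition triangular_tiling : sgraph (int * int) :=
  SGraph tri_adj_sym tri_adj_irrefl.

(* Up to isomorphism, and not necessarily induced. *)
Definition subgraph (V W : Type) (G : sgraph V) (H : sgraph W) : Prop :=
  exists f : V -> W,
    injective f /\ forall u v, adj G u v -> adj H (f u) (f v).

(* Main.v *)
Require Import Defs.
From mathcomp Require Import all_boot all_order all_algebra.
From mathcomp Require Import ring lra zify.
From mathcomp Require Import boolp classical_sets functions cardinality reals.
From mathcomp Require complex.
Set Implicit Arguments.
Unset Strict Implicit.
Unset Printing Implicit Defensive.
Import Order.TTheory GRing.Theory Num.Theory.
Local Open Scope classical_set_scope.
Local Open Scope ring_scope.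

(** If the ply-disks of adjacent [u] and [v] are disjoint, each of radius at
    least half of |uv|, then both radii equal |uv|/2. Hence the edges of a
    component all have the same length l, and the disks of its vertices,
    being disjoint of radius l/2, keep their centers at distance at least l.
    After rescaling the components to l = 1 and moving them apart, all
    vertices are at distance at least 1 from every non-isolated vertex,
    while edges of the square have length at most 2, so their disks have
    radius at most 1. Components with the same l need not be separated, so
    the translation only depends on l.

    For the triangular tiling the drawing of the tiling itself works: two
    distinct lattice points that are congruent modulo 2 are at distance at
    least 2, hence an open disk of radius 1 contains at most one point of
    each of the four classes modulo 2. *)

Section Cardinality.

Lemma finite_set_max (disp : Order.disp_t) (T : orderType disp) (A : set T) :
  finite_set A -> A !=set0 -> exists2 m, A m & ubound A m.
Proof.
move=> /finite_seqP[s ->] [x xs].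
case: (@arg_maxP _ _ _ (SeqSub xs) xpredT (@ssval _ s)) => // m _ m_max.
by exists (ssval m) => [|y ys]; [exact: ssvalP | exact: (m_max (SeqSub ys))].
Qed.

Lemma card_le1_subset1 (T : Type) (A : set T) :
  (A #<= `I_1)%card -> is_subset1 A.
Proof.
move=> /pcard_leP[f] x y Ax Ay; apply: ('inj_f); rewrite ?inE //.
have /= := 'funS_f Ax; have /= := 'funS_f Ay.
by case: (f x) (f y) => [|//] [].
Qed.

Lemma card_le_finType (T : Type) (C : finType) (A : set T) (c : T -> C) :
  {in A &, injective c} -> (A #<= `I_#|C|)%card.
Proof.
move=> c_inj; have rank_inj : {in A &, injective (enum_rank \o c)}.
  by move=> x y Ax Ay /enum_rank_inj; exact: c_inj.
by rewrite -(card_le_eql (inj_card_eq rank_inj)) (card_le_eqr card_II) card_leT.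
Qed.

End Cardinality.

Section EuclideanDistance.
Variable R : realType.
Implicit Types p q r : R * R.

Lemma edistE p q :
  edist p q = complex.ComplexField.Normc.normc
                (complex.Complex (p.1 - q.1) (p.2 - q.2)).
Proof. by []. Qed.

Lemma edist_ge0 p q : 0 <= edist p q.
Proof. exact: sqrtr_ge0. Qed.

Lemma edist_sqr p q : edist p q ^+ 2 = (p.1 - q.1) ^+ 2 + (p.2 - q.2) ^+ 2.
Proof. by rewrite sqr_sqrtr // addr_ge0 ?sqr_ge0. Qed.

Lemma edistxx p : edist p p = 0.
Proof. by rewrite /edist !subrr expr0n /= addr0 sqrtr0. Qed.

Lemma edist_gt0 p q : p <> q -> 0 < edist p q.
Proof.
case: p q => [p1 p2] [q1 q2] pq; rewrite lt_def edist_ge0 andbT edistE.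
apply: contra_not_neq pq => /complex.ComplexField.Normc.eq0_normc[].
by move=> /subr0_eq-> /subr0_eq->.
Qed.

Lemma edist_triangle q p r : edist p r <= edist p q + edist q r.
Proof.
rewrite !edistE; apply: le_trans (complex.le_normcD _ _).
by rewrite /= !addrA !subrK.
Qed.

Lemma edist_proportional (k : R) p q p' q' :
  p.1 - q.1 = k * (p'.1 - q'.1) -> p.2 - q.2 = k * (p'.2 - q'.2) ->
  edist p q = `|k| * edist p' q'.
Proof.
rewrite /edist => -> ->.
by rewrite !exprMn -mulrDr sqrtrM ?sqr_ge0 // sqrtr_sqr.
Qed.

Lemma edistC p q : edist p q = edist q p.
Proof.
by rewrite -[RHS]mul1r -(normrN1 R); apply: edist_proportional; ring.
Qed.

Lemma norm_fst_le_edist p q : `|p.1 - q.1| <= edist p q.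
Proof. by rewrite -sqrtr_sqr ler_wsqrtr // lerDl sqr_ge0. Qed.

Lemma exists_edist_split p q (t : R) : 0 <= t <= 1 ->
  exists r, edist p r = t * edist p q /\ edist q r = (1 - t) * edist p q.
Proof.
move=> /andP[t_ge0 t_le1].
exists (p.1 + t * (q.1 - p.1), p.2 + t * (q.2 - p.2)); split.
  rewrite -[t in RHS](ger0_norm t_ge0).
  by apply: edist_proportional => /=; ring.
rewrite (edistC p) -[1 - t]ger0_norm ?subr_ge0 //.
by apply: edist_proportional => /=; ring.
Qed.

Lemma open_disks_meet p q (a b : R) : 0 < a -> 0 < b -> edist p q < a + b ->
  exists r, edist p r < a /\ edist q r < b.
Proof.
move=> a_gt0 b_gt0 pq; have ab_gt0 : 0 < a + b by rewrite addr_gt0.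
have [|r [pr qr]] := @exists_edist_split p q (a / (a + b)).
  rewrite divr_ge0 ?(ltW a_gt0) ?(ltW ab_gt0) //=.
  by rewrite ler_pdivrMr // mul1r lerDl ltW.
have weights : 1 - a / (a + b) = b / (a + b) by field; rewrite gt_eqF.
exists r; rewrite pr qr weights !(mulrAC _ (a + b)^-1).
by rewrite !ltr_pdivrMr // !ltr_pM2l.
Qed.

End EuclideanDistance.

Lemma exists_separating_slope (R : realType) (V : Type) (x l : V -> R) (e : R) :
  finite_set [set: V] ->
  exists K, forall u v, l u != l v ->
    e <= `|(x u + K * l u) - (x v + K * l v)|.
Proof.
move=> V_fin; pose slope u v := (e + `|x u - x v|) / `|l u - l v|.
have [|| K _ K_ub] := @finite_set_max _ R
  (0 |` [set slope u v | u in [set: V] & v in [set: V]]).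
- by rewrite finite_setU; split; [exact: finite_set1 | exact: finite_image2].
- by exists 0; left.
exists K => u v; rewrite -subr_eq0 -normr_gt0 => luv.
have K_ge0 : 0 <= K by apply: K_ub; left.
have : slope u v <= K by apply: K_ub; right; exists u => //; exists v.
rewrite ler_pdivrMr // -{1}(ger0_norm K_ge0) -normrM -lerBrDr.
move=> /le_trans; apply.
have -> : x u + K * l u - (x v + K * l v) = K * (l u - l v) + (x u - x v).
  by ring.
exact: lerB_normD.
Qed.

Lemma exists_has_ply (R : realType) (V : Type) (G : sgraph V)
    (d : V -> R * R) (n : nat) :
  (forall p, (disks_at G d p #<= `I_n)%card) ->
  exists k, (k <= n)%N /\ has_ply G d k.
Proof.
move=> le_n; pose cards := [set k | exists p, (disks_at G d p #= `I_k)%card].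
have cards_le k : cards k -> (k <= n)%N.
  by move=> [p pk]; rewrite -card_le_II -(card_le_eql pk).
have disks_fin p := card_le_finite (le_n p) (finite_II n).
have [||k cards_k k_max] := @finite_set_max _ nat cards.
- exact: sub_finite_set (finite_II n.+1).
- by have [k k_card] := disks_fin (0, 0); exists k, (0, 0).
exists k; split; first exact: cards_le.
split=> // p; have [j pj] := disks_fin p.
by rewrite (card_le_eql pj) card_le_II; apply: k_max; exists p.
Qed.

Lemma adj_neq (V : Type) (G : sgraph V) u v : adj G u v -> u <> v.
Proof. by move=> uv eq_uv; apply: (@adj_irrefl _ G v); rewrite -{1}eq_uv. Qed.

Section SquareDrawing.
Variables (R : realType) (V : Type) (G : sgraph V) (d : V -> R * R) (l : R).
Hypothesis edge_le : forall u v, adj G u v -> edist (d u) (d v) <= l.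

Lemma walk_edist_le n u v : walk G n u v -> edist (d u) (d v) <= l *+ n.
Proof.
elim: n u => [u ->|n IHn u [w [uw wv]]]; first by rewrite edistxx.
by rewrite mulrS; apply: le_trans (edist_triangle (d w) _ _) (lerD _ _);
  [exact: edge_le | exact: IHn].
Qed.

Lemma square_adj_edist_le u v : square_adj G u v -> edist (d u) (d v) <= l *+ 2.
Proof.
case=> [uv|[_ [uv _]]]; last exact: walk_edist_le uv.
have := edge_le uv; have := edist_ge0 (d u) (d v); rewrite mulr2n; lra.
Qed.

Lemma square_adj_nonisolated u v : square_adj G u v -> adj G u !=set0.
Proof. by case=> [uv|[_ [[w [uw _]] _]]]; [exists v | exists w]. Qed.

Lemma square_ply_disk v p :
  ply_disk (square G) d v p -> adj G v !=set0 /\ edist (d v) p < l.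
Proof.
move=> [len [[[w [vw <-]] _] vp]].
split; first exact: square_adj_nonisolated vw.
by have := square_adj_edist_le vw; rewrite mulr2n; lra.
Qed.

Lemma square_empty_ply :
  (forall v w, adj G v !=set0 -> v <> w -> l <= edist (d v) (d w)) ->
  empty_ply (square G) d.
Proof.
move=> dist_ge v w /nesym vw /square_ply_disk[v_adj].
by rewrite ltNge dist_ge.
Qed.

Lemma square_disks_card_le (C : finType) (c : V -> C) p :
  (forall u v, u <> v -> c u = c v -> l *+ 2 <= edist (d u) (d v)) ->
  (disks_at (square G) d p #<= `I_#|C|)%card.
Proof.
move=> dist_ge; apply: (@card_le_finType _ _ _ c) => u v.
rewrite !inE => /square_ply_disk[_ up] /square_ply_disk[_ vp] cuv.
apply: contrapT => /dist_ge /(_ cuv).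
by have := edist_triangle p (d u) (d v); rewrite (edistC p) mulr2n; lra.
Qed.

End SquareDrawing.

Definition edge_length (R : realType) (V : Type) (G : sgraph V)
    (d : V -> R * R) (v : V) : R :=
  sup [set edist (d v) (d w) | w in adj G v].

Section EdgeLength.
Variables (R : realType) (V : Type) (G : sgraph V) (d : V -> R * R).

Lemma edge_length_neq0 v : edge_length G d v != 0 -> adj G v !=set0.
Proof.
apply: contra_neqP => /nonemptyPn adj0.
by rewrite /edge_length adj0 image_set0 sup0.
Qed.

Lemma edge_length_longest v : finite_set (adj G v) -> adj G v !=set0 ->
  longest_edge G d v (edge_length G d v).
Proof.
move=> adj_fin v_adj; pose lengths := [set edist (d v) (d w) | w in adj G v].
have [||m lengths_m m_max] := @finite_set_max _ R lengths.
- exact: finite_image.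
- by have [w vw] := v_adj; exists (edist (d v) (d w)), w.
have -> : edge_length G d v = m.
  apply/eqP; rewrite eq_le ge_sup //=; last by exists m.
  by rewrite ub_le_sup //; exists m.
split=> [|w vw]; first by have [w vw <-] := lengths_m; exists w.
by apply: m_max; exists w.
Qed.

End EdgeLength.

Lemma has_ply1_trivIset (R : realType) (V : Type) (G : sgraph V)
    (d : V -> R * R) :
  has_ply G d 1 -> trivIset [set: V] (ply_disk G d).
Proof.
move=> [le1 _] u v _ _ [p [up vp]].
exact: card_le1_subset1 (le1 p) _ _ up vp.
Qed.

Section DisjointDisks.
Variables (R : realType) (V : Type) (G : sgraph V) (d : V -> R * R).
Hypothesis d_inj : drawing d.
Hypothesis disks_disjoint : trivIset [set: V] (ply_disk G d).
Hypothesis locally_finite : forall v, finite_set (adj G v).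

Local Notation len := (edge_length G d).

Lemma edge_length_gt0 v : adj G v !=set0 -> 0 < len v.
Proof.
move=> v_adj.
have [[w [vw <-]] _] := edge_length_longest d (locally_finite v) v_adj.
by apply: edist_gt0 => /d_inj; exact: adj_neq vw.
Qed.

Lemma edge_length_separated u v : u <> v -> adj G u !=set0 -> adj G v !=set0 ->
  (len u + len v) / 2 <= edist (d u) (d v).
Proof.
move=> uv u_adj v_adj; rewrite leNgt mulrDl; apply/negP => near; apply: uv.
have [||p [up vp]] := open_disks_meet _ _ near;
  rewrite ?divr_gt0 ?edge_length_gt0 //.
apply: disks_disjoint => //; exists p.
by split; [exists (len u) | exists (len v)]; split=> //;
  exact: edge_length_longest.
Qed.

Lemma adj_edge_length u v : adj G u v ->
  len v = len u /\ edist (d u) (d v) = len u.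
Proof.
move=> uv; have vu := adj_sym uv.
have u_adj : adj G u !=set0 by exists v.
have v_adj : adj G v !=set0 by exists u.
have := edge_length_separated (adj_neq uv) u_adj v_adj.
have := (edge_length_longest d (locally_finite u) u_adj).2 _ uv.
have := (edge_length_longest d (locally_finite v) v_adj).2 _ vu.
by rewrite edistC => ? ? ?; split; lra.
Qed.

(* [len v = sup set0 = 0] at an isolated vertex: inverting it would collapse the
   isolated vertices to one point. *)
Definition unit_scale (v : V) : R := if len v == 0 then 1 else (len v)^-1.

Definition unit_drawing (K : R) (v : V) : R * R :=
  (unit_scale v * (d v).1 + K * len v, unit_scale v * (d v).2).

Lemma unit_scale_gt0 v : 0 < unit_scale v.
Proof.
rewrite /unit_scale; case: eqVneq => // len_neq0.
by rewrite invr_gt0 edge_length_gt0 //; exact: edge_length_neq0 len_neq0.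
Qed.

Lemma unit_scaleE v : adj G v !=set0 -> unit_scale v = (len v)^-1.
Proof. by move=> /edge_length_gt0 len_gt0; rewrite /unit_scale gt_eqF. Qed.

Lemma edist_unit_drawing K u v : len u = len v ->
  edist (unit_drawing K u) (unit_drawing K v) =
  unit_scale u * edist (d u) (d v).
Proof.
move=> len_uv; rewrite -[unit_scale u in RHS]gtr0_norm ?unit_scale_gt0 //.
by apply: edist_proportional; rewrite /= /unit_scale len_uv; ring.
Qed.

Lemma exists_unit_drawing_separated : finite_set [set: V] ->
  exists K, forall u v, len u != len v ->
    1 <= edist (unit_drawing K u) (unit_drawing K v).
Proof.
move=> V_fin; have [K far] :=
  exists_separating_slope (fun v => unit_scale v * (d v).1) len 1 V_fin.
exists K => u v /far /le_trans; apply.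
exact: (norm_fst_le_edist (unit_drawing K u) (unit_drawing K v)).
Qed.

Lemma unit_drawing_adj K u v : adj G u v ->
  edist (unit_drawing K u) (unit_drawing K v) = 1.
Proof.
move=> uv; have u_adj : adj G u !=set0 by exists v.
have [len_vu d_uv] := adj_edge_length uv.
rewrite edist_unit_drawing // unit_scaleE // d_uv mulVf //.
by rewrite gt_eqF ?edge_length_gt0.
Qed.

Section Separated.
Variable K : R.
Hypothesis far : forall u v, len u != len v ->
  1 <= edist (unit_drawing K u) (unit_drawing K v).

Lemma unit_drawing_inj : drawing (unit_drawing K).
Proof.
move=> u v eq_uv; have edist0 : edist (unit_drawing K u) (unit_drawing K v) = 0.
  by rewrite eq_uv edistxx.
have [len_uv|/far] := eqVneq (len u) (len v); last by rewrite edist0 ler10.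
apply: contrapT => uv; have d_uv : d u <> d v by move=> /d_inj.
have := mulr_gt0 (unit_scale_gt0 u) (edist_gt0 d_uv).
by rewrite -(edist_unit_drawing K) // edist0 ltxx.
Qed.

Lemma unit_drawing_edist_ge1 v w : adj G v !=set0 -> v <> w ->
  1 <= edist (unit_drawing K v) (unit_drawing K w).
Proof.
move=> v_adj vw; have [len_vw|/far//] := eqVneq (len v) (len w).
have len_gt0 := edge_length_gt0 v_adj.
have w_adj : adj G w !=set0.
  by apply: (@edge_length_neq0 _ _ _ d); rewrite -len_vw gt_eqF.
rewrite edist_unit_drawing // unit_scaleE // ler_pdivlMl // mulr1.
by have := edge_length_separated vw v_adj w_adj; rewrite -len_vw; lra.
Qed.

End Separated.

End DisjointDisks.

Section TriangularLattice.
Implicit Types x y : int * int.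

Definition eisenstein_norm (a b : int) : int := a ^+ 2 + a * b + b ^+ 2.

Lemma eisenstein_norm_ge1 a b : (a, b) <> (0, 0) -> 1 <= eisenstein_norm a b.
Proof.
move=> ab; have : a <> 0 \/ b <> 0.
  have [a0|/eqP] := eqVneq a 0; last by left.
  by right=> b0; apply: ab; rewrite a0 b0.
by rewrite /eisenstein_norm; case=> ?; nia.
Qed.

Definition tri_parity x : bool * bool := ((2 %| x.1)%Z, (2 %| x.2)%Z).

Variable R : realType.

Lemma tri_edist_sqr x y : edist (tri_pos R x) (tri_pos R y) ^+ 2 =
  (eisenstein_norm (x.1 - y.1) (x.2 - y.2))%:~R.
Proof.
have sqrt3_sqr : Num.sqrt 3 ^+ 2 = 3 :> R by rewrite sqr_sqrtr.
rewrite edist_sqr /= -mulrBl exprMn expr_div_n sqrt3_sqr.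
by rewrite !(intrD, intrM, rmorphXn, rmorphB) /=; field.
Qed.

Lemma tri_edist_ge_dvd (m : nat) x y : x <> y ->
  (m %| x.1 - y.1)%Z -> (m %| x.2 - y.2)%Z ->
  m%:R <= edist (tri_pos R x) (tri_pos R y).
Proof.
case: x y => [x1 x2] [y1 y2] xy /dvdzP[a /= a_def] /dvdzP[b /= b_def].
have ab : (a, b) <> (0, 0).
  move=> [a0 b0]; apply: xy; move: a_def b_def.
  by rewrite a0 b0 !mul0r => /subr0_eq-> /subr0_eq->.
rewrite -ler_sqr ?nnegrE ?edist_ge0 // tri_edist_sqr /= a_def b_def.
have -> : eisenstein_norm (a * m) (b * m) = m%:Z ^+ 2 * eisenstein_norm a b.
  by rewrite /eisenstein_norm; ring.
rewrite intrM rmorphXn ler_peMr ?exprn_ge0 // ler1z.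
exact: eisenstein_norm_ge1.
Qed.

Lemma tri_edist_ge1 x y : x <> y -> 1 <= edist (tri_pos R x) (tri_pos R y).
Proof. by move=> xy; apply: (@tri_edist_ge_dvd 1); rewrite ?dvd1z. Qed.

Lemma tri_pos_inj : injective (tri_pos R).
Proof.
move=> x y eq_xy; apply: contrapT => /tri_edist_ge1.
by rewrite eq_xy edistxx ler10.
Qed.

Lemma tri_edist_parity_ge2 x y : x <> y -> tri_parity x = tri_parity y ->
  2 <= edist (tri_pos R x) (tri_pos R y).
Proof. by move=> xy [? ?]; apply: (@tri_edist_ge_dvd 2) => //; lia. Qed.

End TriangularLattice.

Theorem theorem9 (R : realType) (V : Type) (G : sgraph V) :
  (finite_set [set: V] ->
   (exists d : V -> R * R, drawing d /\ has_ply G d 1) ->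
   exists d : V -> R * R, drawing d /\ empty_ply (square G) d)
  /\
  (subgraph G triangular_tiling ->
   exists d : V -> R * R,
     drawing d /\ empty_ply (square G) d /\
     exists k : nat, (k <= 4)%N /\ has_ply (square G) d k).
Proof.
split=> [V_fin [d [d_inj /has_ply1_trivIset disjoint]]|[f [f_inj f_adj]]].
  have adj_fin v : finite_set (adj G v) by exact: sub_finite_set V_fin.
  have [K far] := exists_unit_drawing_separated G d V_fin.
  exists (unit_drawing G d K); split; first exact: unit_drawing_inj.
  apply: (@square_empty_ply _ _ _ _ 1) => [u v uv|v w].
    by rewrite unit_drawing_adj.
  exact: unit_drawing_edist_ge1.
pose d := tri_pos R \o f; exists d.
have edge_le1 u v : adj G u v -> edist (d u) (d v) <= 1.
  by move=> /f_adj /(tri_adjE R) ->.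
split; [exact: inj_comp (@tri_pos_inj R) f_inj | split].
  apply: (square_empty_ply edge_le1) => v w _ vw.
  by apply: tri_edist_ge1 => /f_inj.
have card_parity : #|{: bool * bool}| = 4%N by rewrite card_prod card_bool.
apply: exists_has_ply => p; rewrite -card_parity.
apply: (square_disks_card_le (c := tri_parity \o f) edge_le1) => u v uv.
by apply: tri_edist_parity_ge2 => /f_inj.
Qed.
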